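(* For every positive integer $n$, $$n!=\sum_{i=0}^n(-1)^{n-i}\binom{n}{i} i^n.$$ *)

(* Defs.v *)
From mathcomp Require Export all_boot all_order all_algebra.

(* Main.v *)
Require Import Defs.
From mathcomp Require Import all_boot all_order all_algebra.
Import GRing.Theory.
Local Open Scope ring_scope.

(** The right-hand side is the [n]-th finite difference at [0] of the function
    [i |-> i ^ n], and this difference of a monomial [i ^ m] vanishes for
    [m < n] and is [n!] for [m = n]. Absorbing one factor [i] into the binomial
    coefficient, [i * 'C(n, i) = n * 'C(n.-1, i.-1)], lowers the order of the
    difference but shifts the monomial to [(i + 1) ^ m], whose expansion involves
    every exponent up to [m] ([diff_powS]). By induction only the exponent equal
    to the order survives, with coefficient [1], and the factors [n] pulled out
    along the way multiply to [n!] ([diff_pow_fact]). *)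

Definition diff_pow (R : comNzRingType) (n m : nat) : R :=
  \sum_(i < n.+1) (-1) ^+ (n - i) * 'C(n, i)%:R * i%:R ^+ m.

(** This is the binomial expansion of [(1 - 1) ^ n.+1]. *)
Lemma diff_pow0 (R : comNzRingType) (n : nat) : diff_pow R n.+1 0 = 0.
Proof.
have := exprDn (-1 : R) 1 n.+1.
rewrite addNr expr0n /= => /esym; apply: etrans; apply: eq_bigr => i _.
by rewrite expr0 expr1n !mulr1 mulr_natr.
Qed.

(** Absorbing one factor [i] into ['C(n.+1, i)] kills the term [i = 0]; after
    reindexing, what is left is the difference of order [n] of [(i + 1) ^ m],
    which is linear in the monomials of its binomial expansion. *)
Lemma diff_powS (R : comNzRingType) (n m : nat) :
  diff_pow R n.+1 m.+1 = n.+1%:R * \sum_(j < m.+1) 'C(m, j)%:R * diff_pow R n j.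
Proof.
rewrite /diff_pow big_ord_recl expr0n mulr0 add0r.
under [in RHS]eq_bigr => j _ do rewrite mulr_sumr.
rewrite exchange_big mulr_sumr; apply: eq_bigr => i _ /=.
rewrite /bump /= add1n subSS.
have absorb : 'C(n.+1, i.+1)%:R * i.+1%:R = n.+1%:R * 'C(n, i)%:R :> R.
  by rewrite -!natrM mulnC -mul_bin_diag.
have shift : i.+1%:R ^+ m = \sum_(j < m.+1) 'C(m, j)%:R * i%:R ^+ j :> R.
  rewrite -add1n natrD exprDn; apply: eq_bigr => j _.
  by rewrite expr1n mul1r mulr_natl.
rewrite exprS mulrA -(mulrA _ 'C(n.+1, i.+1)%:R) absorb shift mulrCA -mulrA.
by congr (_ * _); rewrite mulr_sumr; apply: eq_bigr => j _; rewrite mulrCA.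
Qed.

(** The case [m < n] is included because it makes all the lower terms of
    [diff_powS] vanish when [m = n] is reached by induction. *)
Lemma diff_pow_fact (R : comNzRingType) (n m : nat) :
  (m <= n)%N -> diff_pow R n m = if m == n then n`!%:R else 0.
Proof.
elim: n m => [|n IHn] [|m] //= le_mn.
- by rewrite /diff_pow big_ord1 !expr0 !mul1r.
- exact: diff_pow0.
rewrite diff_powS big_ord_recr /= binn mul1r IHn // big1 => [|j _].
  by rewrite add0r eqSS; case: eqP => _; rewrite ?mulr0 // factS natrM.
have lt_jn : (j < n)%N := leq_trans (ltn_ord j) le_mn.
by rewrite IHn ?(ltnW lt_jn) // (ltn_eqF lt_jn) mulr0.
Qed.

Theorem proposition1 (n : nat) (hn : (0 < n)%N) :
  n`!%:Z =
  \sum_(0 <= i < n.+1) (-1) ^+ (n - i) * 'C(n, i)%:Z * i%:Z ^+ n.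
Proof.
have := diff_pow_fact int n n (leqnn n); rewrite eqxx natz => <-.
by rewrite big_mkord; apply: eq_bigr => i _; rewrite !natz.
Qed.
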